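(* Let $n\ge1$ be an integer, $p>1$ and $\lambda\in\mathbb C\setminus\{0\}$. Let $\alpha\in\mathbb C$ satisfy $\mathrm{Re}(\alpha\lambda)>0$, let $n/2<k<1/(p-1)$, and let $f\in L^2(\mathbb R^n)$ satisfy $$-\mathrm{Im}(\alpha f(x))\ge\begin{cases}0,&\text{if }|x|\le1,\\ |x|^{-k},&\text{if }|x|>1.\end{cases}$$ For $\mu>0$ put $u_0=\mu f$. Then there exist $\mu_0>0$ and a constant $C>0$ independent of $\mu$ such that for every $0<\mu<\mu_0$ and for every sufficiently small $m$ (that is, for every $0\le m\le m_0$ with some $m_0=m_0(\mu)>0$) there exists $R_2>0$ satisfying $$M_{R_2}(0)>\widetilde C_{n,p,\alpha}\,\langle R_2m\rangle^{(n+2)/(p-1)}\,R_2^{\,n-1/(p-1)}$$ and $$\widetilde T_{n,p,m,\lambda,\alpha,R_2}\le C\mu^{-\frac{1}{1/(p-1)-\min(n,k)}}.$$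
   Context: Notation: $\langle x\rangle=(1+|x|^2)^{1/2}$ for $x\in\mathbb R^n$ or $x\in\mathbb R$; $p'=p/(p-1)$. For $R>0$ and initial data $u_0$, $$M_R(0)=-\mathrm{Im}\Bigl(\alpha\int_{\mathbb R^n}u_0(x)\langle x/R\rangle^{-n-1}\,dx\Bigr).$$ The constants are: $\widetilde C_{n,p,\alpha}>0$ with $$\widetilde C_{n,p,\alpha}^{\,p}=2^{1+p'/p}\,p^{-p'/p}\,p'^{-1}\,\mathrm{Re}(\alpha\lambda)^{-p'}\,|\alpha|^{p+p'}\,\widetilde A_n^{\,p'}\Bigl(\int_{\mathbb R^n}\langle x\rangle^{-n-1}\,dx\Bigr)^p,$$ $$D_{n,p,\lambda,\alpha}=2^{-1}\,\mathrm{Re}(\alpha\lambda)\,|\alpha|^{-p}\Bigl(\int_{\mathbb R^n}\langle x\rangle^{-n-1}\,dx\Bigr)^{-p+1},$$ $$\widetilde T_{n,p,m,\lambda,\alpha,R}=(p-1)^{-1}D_{n,p,\lambda,\alpha}^{-1}\,R^{n(p-1)}\Bigl(M_R(0)-\langle Rm\rangle^{(n+2)/(p-1)}\,\widetilde C_{n,p,\alpha}\,R^{\,n-1/(p-1)}\Bigr)^{-p+1}.$$ Here $\widetilde A_n=A_{n,n+1}+2^{(n+1)/2}\|\langle\cdot\rangle^{n+1}K\|_{L^1(\mathbb R^n)}$, where $K$ is the integral kernel of the Bessel potential $(1-\Delta)^{-1/2}$ (Fourier multiplier with symbol $(1+|\xi|^2)^{-1/2}$), i.e. $(1-\Delta)^{-1/2}\phi=K*\phi$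 for Schwartz $\phi$, and $A_{n,n+1}$ is a positive constant, depending only on $n$, such that $|((-\Delta)^{1/2}\langle\cdot\rangle^{-n-1})(x)|\le A_{n,n+1}\langle x\rangle^{-n-1}$ for all $x\in\mathbb R^n$ (such a constant is known to exist; $(-\Delta)^{1/2}$ is the Fourier multiplier with symbol $|\xi|$). ($\widetilde T_{n,p,m,\lambda,\alpha,R}$ is the upper bound for the existence time of solutions of $i\partial_tu+(m^2-\Delta)^{1/2}u=\lambda|u|^p$, $u(0)=u_0$.) *)

(* Defs.v *)
From HB Require Import structures.
From mathcomp Require Import all_boot all_order all_algebra.
From mathcomp Require Import complex.
From mathcomp Require Import all_classical all_reals all_analysis.

Set Implicit Arguments.
Unset Strict Implicit.
Unset Printing Implicit Defensive.
Import Order.TTheory GRing.Theory Num.Theory.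
Import numFieldNormedType.Exports.
Local Open Scope classical_set_scope.
Local Open Scope ring_scope.

(* 'rV[T]_n carries the sigma-algebra generated by the coordinates; for T = R
   this is the Borel sigma-algebra. *)
Definition row_display : measure_display -> measure_display.
Proof. exact. Qed.

Section measurable_row.
Context {d} {T : measurableType d}.
Variable n : nat.

Let coord : 'I_n -> 'rV[T]_n -> T := fun i x => x 0 i.

Let row_set0 : g_sigma_preimage coord set0.
Proof. exact: sigma_algebra0. Qed.

Let row_setC A : g_sigma_preimage coord A -> g_sigma_preimage coord (~` A).
Proof. exact: sigma_algebraC. Qed.

Let row_bigcup (F : _^nat) : (forall i, g_sigma_preimage coord (F i)) ->
  g_sigma_preimage coord (\bigcup_i (F i)).
Proof. exact: sigma_algebra_bigcup. Qed.

HB.instance Definition _ := @isMeasurable.Build (row_display d)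
  'rV[T]_n (g_sigma_preimage coord) row_set0 row_setC row_bigcup.

Lemma measurable_coord (i : 'I_n) :
  measurable_fun [set: 'rV[T]_n] (fun x : 'rV[T]_n => x 0 i).
Proof.
move=> _ Y mY; rewrite setTI; apply: sub_sigma_algebra => /=.
rewrite -bigcup_seq/=; exists i => /=; first by rewrite mem_index_enum.
by exists Y => //; rewrite setTI.
Qed.

Lemma measurable_fun_row d' (X : measurableType d') (f : X -> 'rV[T]_n) :
  (forall i, measurable_fun setT (fun x => f x 0 i)) -> measurable_fun setT f.
Proof.
move=> mf _ A; rewrite {1}/measurable/= => mA; rewrite setTI.
suff: (measurable : set (set 'rV[T]_n)) `<=` [set A | measurable (f @^-1` A)].
  exact.
apply: smallest_sub.
  split=> /=.
  - by rewrite preimage_set0.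
  - by move=> B mB; rewrite setTD preimage_setC; exact: measurableC.
  - by move=> F mF; rewrite preimage_bigcup; exact: bigcup_measurable.
rewrite -bigcup_seq => B [i _] [C mC <-] /=.
by rewrite setTI -[X in measurable X]setTI; exact: mf.
Qed.

End measurable_row.

(* Lebesgue measure on 'rV[R]_n, as an iterated product. *)
Section lebesgue_row.
Context {R : realType}.

Definition row_cons n (p : R * 'rV[R]_n) : 'rV[R]_n.+1 :=
  row_mx (const_mx p.1 : 'rV_1) p.2.

Definition row_uncons n (x : 'rV[R]_n.+1) : R * 'rV[R]_n :=
  ((x : 'rV_(1 + n)) 0 (lshift n 0), rsubmx (x : 'rV_(1 + n))).

Lemma row_consK n : cancel (@row_cons n) (@row_uncons n).
Proof.
by case=> a x; rewrite /row_uncons /row_cons row_mxKr row_mxEl mxE.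
Qed.

Lemma measurable_row_cons n : measurable_fun setT (@row_cons n).
Proof.
apply: measurable_fun_row => i.
rewrite -(splitK (i : 'I_(1 + n))); case: (fintype.split _) => j /=.
  rewrite (_ : (fun _ => _) = fst); first exact: measurable_fst.
  by apply/funext => p; rewrite [LHS]row_mxEl mxE ?ord1.
rewrite (_ : (fun _ => _) = (fun x : 'rV[R]_n => x 0 j) \o snd).
  exact: (measurableT_comp (measurable_coord j) measurable_snd).
by apply/funext => p; exact: row_mxEr.
Qed.

Lemma measurable_row_uncons n : measurable_fun setT (@row_uncons n).
Proof.
apply/measurable_fun_pair; first exact: measurable_coord.
apply: measurable_fun_row => i; under eq_fun do rewrite mxE.
exact: measurable_coord.
Qed.

Section lebesgue_cons.
Context n (mu : {sigma_finite_measure set 'rV[R]_n -> \bar R}).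

Definition lebesgue_cons : set 'rV[R]_n.+1 -> \bar R :=
  pushforward (lebesgue_measure \x mu)%E (@row_cons n).

Let mcons := @measurable_row_cons n.

Let lebesgue_cons0 : lebesgue_cons set0 = 0%E.
Proof. by rewrite /lebesgue_cons /pushforward preimage_set0 measure0. Qed.

Let lebesgue_cons_ge0 A : (0 <= lebesgue_cons A)%E.
Proof. exact: measure_ge0. Qed.

Let lebesgue_cons_sigma_additive : semi_sigma_additive lebesgue_cons.
Proof. exact: measure_semi_sigma_additive. Qed.

HB.instance Definition _ := isMeasure.Build _ _ _ lebesgue_cons
  lebesgue_cons0 lebesgue_cons_ge0 lebesgue_cons_sigma_additive.

Let lebesgue_cons_sigma_finite : sigma_finite setT lebesgue_cons.
Proof.
have /sigma_finiteP[F [TF ndF Foo]] := sigma_finiteT (@lebesgue_measure R).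
have /sigma_finiteP[G [TG ndG Goo]] := sigma_finiteT mu.
exists (fun k => @row_uncons n @^-1` (F k `*` G k)).
  apply/seteqP; split => // x _.
  have [i _ Fi] : (\bigcup_i F i) (row_uncons x).1 by rewrite -TF.
  have [j _ Gj] : (\bigcup_i G i) (row_uncons x).2 by rewrite -TG.
  exists (maxn i j) => //; split.
  - by move: Fi; exact/subsetPset/ndF/leq_maxl.
  - by move: Gj; exact/subsetPset/ndG/leq_maxr.
move=> k; have [mF Fk] := Foo k; have [mG Gk] := Goo k; split.
  rewrite -[X in measurable X]setTI; apply: measurable_row_uncons => //.
  exact: measurableX.
rewrite /lebesgue_cons /pushforward -comp_preimage.
rewrite (_ : _ \o _ = id); last by apply/funext => x; exact: row_consK.
by rewrite preimage_id product_measure1E// lte_mul_pinfty// ge0_fin_numE.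
Qed.

HB.instance Definition _ := Measure_isSigmaFinite.Build _ _ _
  lebesgue_cons lebesgue_cons_sigma_finite.

End lebesgue_cons.

Fixpoint lebesgue_row n : {sigma_finite_measure set 'rV[R]_n -> \bar R} :=
  match n with
  | 0 => \d_(0 : 'rV[R]_0)
  | n'.+1 => lebesgue_cons (lebesgue_row n')
  end.

End lebesgue_row.

Section lebesgue_row_theory.
Context {R : realType}.

Lemma lebesgue_row_box n (A : 'I_n -> set R) :
  (forall i, measurable (A i)) ->
  lebesgue_row n [set x : 'rV[R]_n | forall i, A i (x 0 i)] =
  (\prod_(i < n) lebesgue_measure (A i))%E.
Proof.
elim: n A => [|n IH] A mA.
  by rewrite big_ord0 /= diracE mem_set// => -[].
rewrite big_ord_recl -IH => [|i]; last exact: mA.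
rewrite -product_measure1E; [|exact: mA|]; last first.
  rewrite (_ : [set _ | _] =
      \bigcap_(i in [set: 'I_n]) (fun x : 'rV[R]_n => x 0 i) @^-1` A (lift 0 i)).
    apply: fin_bigcap_measurable => // i _.
    by rewrite -[X in measurable X]setTI; exact: measurable_coord.
  by apply/seteqP; split=> x /= Ax i; [move=> _|]; exact: Ax.
have cons0 (p : R * 'rV[R]_n) : row_cons p 0 0 = p.1.
  rewrite (_ : 0 = lshift n (0 : 'I_1)) /row_cons; last exact/val_inj.
  by rewrite [LHS]row_mxEl mxE.
have consS (p : R * 'rV[R]_n) i : row_cons p 0 (lift 0 i) = p.2 0 i.
  by rewrite -rshift1 /row_cons [LHS]row_mxEr.
apply: (@congr1 _ _ (lebesgue_measure \x lebesgue_row n)%E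
                (@row_cons R n @^-1` _)).
apply/seteqP; split=> -[a x] /=.
  by move=> Ax; split=> [|i]; [have := Ax 0; rewrite cons0|
                               have := Ax (lift 0 i); rewrite consS].
move=> [Aa Ax] i; have [j ->|->] := unliftP 0 i; first by rewrite consS; exact: Ax.
by rewrite cons0.
Qed.

End lebesgue_row_theory.

Section euclidean.
Context {R : realType} {n : nat}.
Implicit Types x y : 'rV[R]_n.

(* The library norm on 'rV[R]_n is the sup norm, hence the explicit formula. *)
Definition enorm x : R := Num.sqrt (\sum_(i < n) x 0 i ^+ 2).

Definition dotp x y : R := \sum_(i < n) x 0 i * y 0 i.

End euclidean.

(* The Japanese bracket of a real number; that of a vector x is jap (enorm x). *)
Definition jap {R : realType} (t : R) : R := Num.sqrt (1 + t ^+ 2).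

Section complex_valued.
Context {R : realType} {n : nat}.
Local Open Scope complex_scope.
Local Notation mu := (lebesgue_row n).
Implicit Types f g : 'rV[R]_n -> R[i].

Definition cmeasurable f : Prop :=
  measurable_fun setT (fun x => complex.Re (f x)) /\
  measurable_fun setT (fun x => complex.Im (f x)).

Definition cintegrable f : Prop :=
  mu.-integrable setT (fun x => (complex.Re (f x))%:E) /\
  mu.-integrable setT (fun x => (complex.Im (f x))%:E).

Definition cintegral f : R[i] :=
  (\int[mu]_x complex.Re (f x)) +i* (\int[mu]_x complex.Im (f x)).

(* f is a Borel representative of its class; every class has one. *)
Definition L2 f : Prop :=
  cmeasurable f /\ finite_norm mu 2%:E (fun x => Normc.normc (f x)).

Definition partials (s : seq 'I_n) (g : 'rV[R]_n -> R) : 'rV[R]_n -> R :=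
  foldr (fun i h x => 'D_(delta_mx 0 i) h x) g s.

(* Bounded partial derivatives of all orders make every one of them Lipschitz,
   hence continuous, so smoothness need not be required separately. *)
Definition schwartz_real (g : 'rV[R]_n -> R) : Prop :=
  forall s : seq 'I_n,
    (forall x i, derivable (partials s g) x (delta_mx 0 i)) /\
    (forall N : nat, exists B : R,
       forall x, jap (enorm x) ^+ N * `|partials s g x| <= B).

Definition schwartz f : Prop :=
  schwartz_real (fun x => complex.Re (f x)) /\
  schwartz_real (fun x => complex.Im (f x)).

Definition expi (t : R) : R[i] := cos t +i* sin t.

(* With symbols expressed in the angular frequency xi, the pair below is
   normalised by (2 pi)^-n on the inverse side; multipliers do not depend on how
   that factor is shared. *)
Definition fourier f (xi : 'rV[R]_n) : R[i] :=
  cintegral (fun x => expi (- dotp x xi) * f x).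

Definition inv_fourier g (x : 'rV[R]_n) : R[i] :=
  ((2 * pi) ^- n)%:C * cintegral (fun xi => expi (dotp x xi) * g xi).

Definition multiplier (m : 'rV[R]_n -> R) f : 'rV[R]_n -> R[i] :=
  inv_fourier (fun xi => (m xi)%:C * fourier f xi).

(* (1 - Delta)^(-1/2) *)
Definition bessel_potential : ('rV[R]_n -> R[i]) -> 'rV[R]_n -> R[i] :=
  multiplier (fun xi => (jap (enorm xi))^-1).

(* (- Delta)^(1/2) *)
Definition half_laplacian : ('rV[R]_n -> R[i]) -> 'rV[R]_n -> R[i] :=
  multiplier enorm.

(* This determines K up to a null set. *)
Definition bessel_kernel (K : 'rV[R]_n -> R[i]) : Prop :=
  cmeasurable K /\
  forall phi, schwartz phi -> forall x,
    cintegrable (fun y => K (x - y) * phi y) /\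
    bessel_potential phi x = cintegral (fun y => K (x - y) * phi y).

End complex_valued.

Section constants.
Context {R : realType} (n : nat).
Local Open Scope complex_scope.
Local Notation mu := (lebesgue_row n).
Local Notation normc := Normc.normc.

Definition weight (x : 'rV[R]_n) : R := jap (enorm x) ^- n.+1.

Definition weight_mass : R := \int[mu]_x weight x.

Definition half_laplacian_bound (A : R) : Prop :=
  forall x, normc (half_laplacian (fun y => (weight y)%:C) x) <= A * weight x.

(* The norm is finite: the Bessel kernel is integrable near 0 and decays
   exponentially, so fine loses nothing. *)
Definition Atilde (A : R) (K : 'rV[R]_n -> R[i]) : R :=
  A + 2 `^ (n.+1%:R / 2) *
      fine ('N[mu]_1 [EFin \o (fun x => jap (enorm x) ^+ n.+1 * normc (K x))%R])%E.

Definition MR (alpha : R[i]) (u0 : 'rV[R]_n -> R[i]) (r : R) : R :=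
  - complex.Im (alpha * cintegral (fun x => u0 x * (weight (r^-1 *: x))%:C)).

(* The positive p-th root of the expression that defines the p-th power. *)
Definition Ctilde (A : R) (K : 'rV[R]_n -> R[i]) (p : R) (lambda alpha : R[i]) :
    R :=
  let p' := p / (p - 1) in
  (2 `^ (1 + p' / p) * p `^ (- (p' / p)) * p'^-1 *
   complex.Re (alpha * lambda) `^ (- p') * normc alpha `^ (p + p') *
   Atilde A K `^ p' * weight_mass `^ p) `^ p^-1.

Definition Dconst (p : R) (lambda alpha : R[i]) : R :=
  2^-1 * complex.Re (alpha * lambda) * normc alpha `^ (- p) *
  weight_mass `^ (- p + 1).

Definition Ttilde (A : R) (K : 'rV[R]_n -> R[i]) (p m : R)
    (lambda alpha : R[i]) (u0 : 'rV[R]_n -> R[i]) (r : R) : R :=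
  (p - 1)^-1 * (Dconst p lambda alpha)^-1 * r `^ (n%:R * (p - 1)) *
  (MR alpha u0 r - jap (r * m) `^ ((n%:R + 2) / (p - 1)) *
     Ctilde A K p lambda alpha * r `^ (n%:R - (p - 1)^-1)) `^ (- p + 1).

End constants.

(* Main.v *)
Require Import Defs.
From mathcomp Require Import all_boot all_order all_algebra.
From mathcomp Require Import complex.
From mathcomp Require Import all_classical all_reals all_analysis.
From mathcomp Require Import measurable_realfun ring lra.

Set Implicit Arguments.
Unset Strict Implicit.
Unset Printing Implicit Defensive.
Import Order.TTheory GRing.Theory Num.Theory.
Import numFieldNormedType.Exports.
Local Open Scope classical_set_scope.
Local Open Scope ring_scope.
Local Open Scope complex_scope.

(** The weighted mean M_R(0) of u0 = mu f grows at least like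
    mu R ^ (n - min(n, k)), whereas the loss term it has to beat is of order
    R ^ (n - 1/(p-1)). Since min(n, k) <= k < 1/(p-1), the mean wins for large
    R, and balancing the two sides up to a constant factor gives the radius
    R = (B / mu) ^ (1 / (1/(p-1) - min(n, k))). At that radius the bound on
    the existence time is a constant times R itself, which is the claimed
    power of mu.

    Growth of the mean ([MR_growth]). The function - Im (alpha f) is
    nonnegative almost everywhere, so the integral over the whole space is at
    least the integral over the cube [r, 2r]^n with 2 <= r <= R. There |x| is
    comparable to r, the density is at least a multiple of r ^ (-k), and the
    weight, evaluated at x / R with |x| <= 2 sqrt n R, is bounded below by a
    constant. The cube has volume r ^ n, whence a lower bound by a multiple of
    r ^ (n - k) ([MR_ge_cube]). One takes r = R when k < n, and the fixed
    r = 2 when n <= k. In dimension n >= 1 this cube avoids the unit ball, where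
    the density is only known to be nonnegative, and its measure is a plain
    product, unlike that of an annulus.

    To move alpha inside the integral and to compare integrals, f times the
    weight must be integrable. As f is square integrable, this follows from
    2 a b <= a^2 + b^2 once the weight is square integrable, and the square
    of the weight is at most the product of the one-dimensional densities
    1 / (1 + x_i^2), to which Tonelli applies ([integral_row_prod],
    [integral_sqr_weight_lty]).

    The choice of the radius ([optimal_radius]) concerns real powers only. The
    mass m enters through <R m>, which is at most <1> as soon as m <= 1 / R;
    this is the smallness required of m. *)

(** * Tonelli for products of one-variable functions *)

Lemma integral_row_prod (R : realType) n (g : 'I_n -> R -> R) :
  (forall i t, 0 <= g i t) -> (forall i, measurable_fun setT (g i)) ->
  (\int[lebesgue_row n]_x (\prod_(i < n) g i (x 0 i))%:E =
   \prod_(i < n) \int[lebesgue_measure]_t (g i t)%:E)%E.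
Proof.
elim: n g => [|n IH] g g0 mg.
  rewrite big_ord0; under eq_integral do rewrite big_ord0.
  by rewrite integral_cst// mul1e /= diracE mem_set.
have mprod m (h : 'I_m -> R -> R) : (forall i, measurable_fun setT (h i)) ->
    measurable_fun setT (fun x : 'rV[R]_m => \prod_(i < m) h i (x 0 i)).
  move=> mh; apply: measurable_prod => i _.
  exact: (measurableT_comp (mh i) (measurable_coord i)).
have cons0 (q : R * 'rV[R]_n) : row_cons q 0 0 = q.1.
  rewrite (_ : 0 = lshift n (0 : 'I_1)) /row_cons; last exact/val_inj.
  by rewrite [LHS]row_mxEl mxE.
have consS (q : R * 'rV[R]_n) i : row_cons q 0 (lift 0 i) = q.2 0 i.
  by rewrite -rshift1 /row_cons [LHS]row_mxEr.
rewrite /= /lebesgue_cons ge0_integral_pushforward//; first last.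
- by move=> x _; rewrite lee_fin prodr_ge0.
- by apply/measurable_EFinP; exact: mprod.
- exact: measurable_row_cons.
rewrite preimage_setT fubini_tonelli1/=; first last.
- by move=> x; rewrite lee_fin prodr_ge0.
- apply: measurableT_comp; last exact: measurable_row_cons.
  by apply/measurable_EFinP; exact: mprod.
rewrite big_ord_recl -IH//.
rewrite -ge0_integralZr//; first last.
- by apply: integral_ge0 => x _; rewrite lee_fin prodr_ge0.
- by move=> x _; rewrite lee_fin.
- by apply/measurable_EFinP; exact: (mg ord0).
apply: eq_integral => t _; rewrite /fubini_F /=.
rewrite -ge0_integralZl//; first last.
- by rewrite lee_fin.
- by move=> x _; rewrite lee_fin prodr_ge0.
- apply/measurable_EFinP.
  by apply: (mprod _ (fun i => g (lift ord0 i))) => i; exact: mg.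
apply: eq_integral => x _.
rewrite big_ord_recl cons0 EFinM; congr (_ * _%:E)%E.
by apply: eq_bigr => i _; rewrite consS.
Qed.

(** * Euclidean norm, Japanese bracket and weight *)

Lemma sqr_jap (R : realType) (t : R) : jap t ^+ 2 = 1 + t ^+ 2.
Proof. by rewrite sqr_sqrtr// addr_ge0// sqr_ge0. Qed.

Lemma jap_ge1 (R : realType) (t : R) : 1 <= jap t.
Proof. by rewrite -[leLHS]sqrtr1 ler_wsqrtr// lerDl sqr_ge0. Qed.

Lemma jap_gt0 (R : realType) (t : R) : 0 < jap t.
Proof. exact: lt_le_trans (jap_ge1 t). Qed.

Lemma ler_jap (R : realType) (s t : R) : 0 <= s -> s <= t -> jap s <= jap t.
Proof.
move=> s0 st; rewrite ler_wsqrtr// lerD2l ler_sqr ?nnegrE//.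
exact: le_trans st.
Qed.

Lemma enorm_ge0 (R : realType) n (x : 'rV[R]_n) : 0 <= enorm x.
Proof. exact: sqrtr_ge0. Qed.

Lemma sqr_enorm (R : realType) n (x : 'rV[R]_n) :
  enorm x ^+ 2 = \sum_(i < n) x 0 i ^+ 2.
Proof. by rewrite sqr_sqrtr// sumr_ge0// => i _; exact: sqr_ge0. Qed.

Lemma enormZ (R : realType) n (a : R) (x : 'rV[R]_n) :
  0 <= a -> enorm (a *: x) = a * enorm x.
Proof.
move=> a0; rewrite /enorm; under eq_bigr do rewrite mxE exprMn.
by rewrite -mulr_sumr sqrtrM ?sqr_ge0// sqrtr_sqr ger0_norm.
Qed.

Lemma measurable_enorm (R : realType) n :
  measurable_fun setT (@enorm R n).
Proof.
rewrite (_ : enorm = fun x : 'rV[R]_n => (\sum_(i < n) x 0 i ^+ 2) `^ 2^-1).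
  apply: (measurableT_comp (measurable_powR _)).
  apply: measurable_sum => i; apply: measurable_funX.
  exact: measurable_coord.
apply/funext => x; rewrite powR12_sqrt// sumr_ge0// => i _; exact: sqr_ge0.
Qed.

Lemma weight_gt0 (R : realType) n (x : 'rV[R]_n) : 0 < weight x.
Proof. by rewrite invr_gt0 exprn_gt0// jap_gt0. Qed.

(** Written with real powers, the weight is a composition of functions that are
    measurable on the whole line, so no case distinction is needed for the
    inverse and the square root. *)
Lemma measurable_weight (R : realType) n (a : R) : 0 <= a ->
  measurable_fun setT (fun x : 'rV[R]_n => weight (a *: x)).
Proof.
move=> a0.
rewrite (_ : (fun _ => _) = fun x : 'rV[R]_n =>
    (1 + (a * enorm x) ^+ 2) `^ (- (n.+1%:R / 2))).
  apply: (measurableT_comp (measurable_powR _)).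
  apply: measurable_funD => //; apply: measurable_funX.
  by apply: measurable_funM => //; exact: measurable_enorm.
apply/funext => x; rewrite /weight enormZ//.
have j0 := ltW (jap_gt0 (a * enorm x)).
rewrite powRN -sqr_jap -[X in X `^ _]powR_mulrn// -powRrM.
by rewrite mulrCA divff// mulr1 powR_mulrn.
Qed.

Lemma weight_scaleE (R : realType) n (a : R) (x : 'rV[R]_n) : 0 <= a ->
  weight (a *: x) = jap (a * enorm x) ^- n.+1.
Proof. by move=> a0; rewrite /weight enormZ. Qed.

Lemma oneDsqr_gt0 (R : realType) (t : R) : 0 < oneDsqr t.
Proof. exact: lt_le_trans (oneDsqr_ge1 t). Qed.

(** Each factor 1 + x_i^2 is at most 1 + |x|^2, and there are n of them against
    the exponent n + 1. *)
Lemma sqr_weight_le (R : realType) n (x : 'rV[R]_n) :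
  weight x ^+ 2 <= \prod_(i < n) (oneDsqr (x 0 i))^-1.
Proof.
rewrite /weight exprVn -exprM mulnC exprM sqr_jap prodfV.
have e0 : 0 < 1 + enorm x ^+ 2 by rewrite ltr_pwDl// sqr_ge0.
rewrite lef_pV2 ?posrE ?exprn_gt0 ?prodr_gt0//.
have e1 : 1 <= 1 + enorm x ^+ 2 by rewrite lerDl sqr_ge0.
apply: le_trans (ler_weXn2l e1 (leqnSn n)).
rewrite -[X in _ <= _ ^+ X]card_ord -prodr_const; apply: ler_prod => i _.
rewrite (le_trans _ (oneDsqr_ge1 _))//= lerD2l sqr_enorm (bigD1 i)//= lerDl.
by rewrite sumr_ge0// => j _; exact: sqr_ge0.
Qed.

Lemma integral_oneDsqrV_lty (R : realType) :
  (\int[@lebesgue_measure R]_t ((oneDsqr t)^-1)%:E < +oo)%E.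
Proof.
rewrite ge0_symfun_integralT/=.
- rewrite -set_itvcy integral0y_oneDsqr -EFinM ltry//.
- by move=> t; rewrite invr_ge0 ltW ?oneDsqr_gt0.
- exact: continuous_oneDsqrV.
- by move=> t; rewrite /= /oneDsqr sqrrN.
Qed.

(** Dilating by s >= 1 costs a factor s^2 in each coordinate, because
    1 + t^2 <= s^2 (1 + (t / s)^2). *)
Lemma integral_sqr_weight_lty (R : realType) n (s : R) : 1 <= s ->
  (\int[lebesgue_row n]_x (weight (s^-1 *: x : 'rV[R]_n) ^+ 2)%:E < +oo)%E.
Proof.
move=> s1; have s0 : 0 < s by exact: lt_le_trans s1.
pose g (t : R) := s ^+ 2 * (oneDsqr t)^-1.
have g0 t : 0 <= g t by rewrite mulr_ge0 ?sqr_ge0// invr_ge0 ltW ?oneDsqr_gt0.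
have mV : measurable_fun setT (fun t : R => (oneDsqr t)^-1).
  by apply: continuous_measurable_fun; exact: continuous_oneDsqrV.
have mg : measurable_fun setT g by exact: measurable_funM.
apply: (@le_lt_trans _ _
    (\int[lebesgue_row n]_x (\prod_(i < n) g (x 0 i))%:E)%E).
  apply: ge0_le_integral => //.
  - by move=> x _; rewrite lee_fin sqr_ge0.
  - apply/measurable_EFinP; apply: measurable_funX; apply: measurable_weight.
    by rewrite invr_ge0 ltW.
  - apply/measurable_EFinP; apply: measurable_prod => i _.
    exact: (measurableT_comp mg (measurable_coord i)).
  - move=> x _; rewrite lee_fin (le_trans (sqr_weight_le _))//.
    apply: ler_prod => i _; rewrite invr_ge0 (ltW (oneDsqr_gt0 _)) mxE /g/=.
    rewrite ler_pdivlMr ?oneDsqr_gt0// mulrC ler_pdivrMr ?oneDsqr_gt0//.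
    rewrite /oneDsqr mulrDr mulr1 -exprMn mulrA divff ?gt_eqF// mul1r lerD2r.
    by rewrite expr_ge1// ltW.
rewrite (@integral_row_prod R n (fun=> g))//.
suff /andP[] :
  (0 <= \prod_(i < n) \int[lebesgue_measure]_t (g t)%:E < +oo)%E by [].
apply: (big_ind (fun z => (0 <= z < +oo)%E)) =>
  [|x y /andP[x0 xoo] /andP[y0 yoo]|i _].
- by rewrite lee01 ltry.
- by rewrite mule_ge0// lte_mul_pinfty// ge0_fin_numE.
rewrite integral_ge0//=; last by move=> t _; rewrite lee_fin.
under eq_integral do rewrite EFinM.
rewrite ge0_integralZl ?lee_fin ?sqr_ge0//; last first.
  by apply/measurable_EFinP; exact: mV.
by rewrite lte_mul_pinfty ?lee_fin ?sqr_ge0// integral_oneDsqrV_lty.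
Qed.

Lemma le_normr_normc (R : realType) (z : R[i]) :
  `|complex.Re z| <= Normc.normc z /\ `|complex.Im z| <= Normc.normc z.
Proof.
case: z => a b /=; rewrite -!sqrtr_sqr.
by split; rewrite ler_wsqrtr// ?lerDl ?lerDr sqr_ge0.
Qed.

(** * The weighted mean as a real integral *)

Section weighted_mean.
Context {R : realType} {n : nat}.
Local Notation mu := (@lebesgue_row R n).
Local Notation V := 'rV[R]_n.

Lemma integral_sqr_L2 (f : V -> R[i]) : L2 f ->
  (\int[mu]_x (Normc.normc (f x) ^+ 2)%:E < +oo)%E.
Proof.
move=> [_]; rewrite /finite_norm => /(poweR_lty 2); rewrite poweR_Lnorm//.
congr (_ < _)%E; apply: eq_integral => x _ /=.
rewrite powR_mulrn ?normr_ge0// real_normK ?num_real//.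
Qed.

(** The case where g is the real or imaginary part of a complex function of
    modulus h: |g| w <= h w <= h^2 + w^2. *)
Lemma integrable_L2_weight (g h : V -> R) (s : R) : 1 <= s ->
  measurable_fun setT g -> measurable_fun setT h ->
  (forall x, `|g x| <= h x) -> (\int[mu]_x (h x ^+ 2)%:E < +oo)%E ->
  mu.-integrable setT (EFin \o (fun x => g x * weight (s^-1 *: x))).
Proof.
move=> s1 mg mh gh hoo.
have mw : measurable_fun setT (fun x : V => weight (s^-1 *: x)).
  by apply: measurable_weight; rewrite invr_ge0 (le_trans _ s1).
apply: (@le_integrable _ _ _ _ _ _ _
    (fun x => (h x ^+ 2)%:E + (weight (s^-1 *: x) ^+ 2)%:E)%E) => //.
- by apply/measurable_EFinP; exact: measurable_funM.
- move=> x _; rewrite -EFinD /= lee_fin normrM (gtr0_norm (weight_gt0 _)).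
  rewrite (@ger0_norm _ (_ + _)) ?addr_ge0 ?sqr_ge0//.
  have := gh x; have := normr_ge0 (g x); have := weight_gt0 (s^-1 *: x).
  set a := `|g x|; set b := h x; set c := weight _ => c0 a0 ab.
  have := sqr_ge0 (b - c); have : a * c <= b * c by rewrite ler_wpM2r// ltW.
  nra.
- apply: integrableD => //; apply/integrableP; split.
  + by apply/measurable_EFinP; exact: measurable_funX.
  + by under eq_integral do rewrite gee0_abs ?lee_fin ?sqr_ge0//.
  + by apply/measurable_EFinP; exact: measurable_funX.
  + under eq_integral do rewrite gee0_abs ?lee_fin ?sqr_ge0//.
    exact: integral_sqr_weight_lty.
Qed.

Lemma cintegrable_L2_weight (f : V -> R[i]) (s : R) : 1 <= s -> L2 f ->
  cintegrable (fun x => f x * (weight (s^-1 *: x))%:C).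
Proof.
move=> s1 f2; have foo := integral_sqr_L2 f2; case: f2 => -[mre mim] _.
have mh : measurable_fun setT (fun x => Normc.normc (f x)).
  rewrite (_ : (fun _ => _) = fun x =>
      (complex.Re (f x) ^+ 2 + complex.Im (f x) ^+ 2) `^ 2^-1).
    apply: (measurableT_comp (measurable_powR _)).
    by apply: measurable_funD => //; exact: measurable_funX.
  apply/funext => x; rewrite powR12_sqrt ?addr_ge0 ?sqr_ge0//.
  by case: (f x).
split.
  have := integrable_L2_weight s1 mre mh
    (fun x => (le_normr_normc (f x)).1) foo.
  congr (_.-integrable _ _); apply/funext => x /=.
  by case: (f x) => a b /=; rewrite mulr0 subr0.
have := integrable_L2_weight s1 mim mh (fun x => (le_normr_normc (f x)).2) foo.
congr (_.-integrable _ _); apply/funext => x /=.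
by case: (f x) => a b /=; rewrite mulr0 add0r.
Qed.

(** The mean is defined by the integrals of the real and imaginary parts of
    f times the weight; linearity collects them into the integral of one real
    function whose sign is known. *)
Lemma MR_integral (alpha : R[i]) (f : V -> R[i]) (s : R) : 1 <= s -> L2 f ->
  mu.-integrable setT
    (EFin \o (fun x => - complex.Im (alpha * f x) * weight (s^-1 *: x))) /\
  MR alpha f s =
    \int[mu]_x (- complex.Im (alpha * f x) * weight (s^-1 *: x)).
Proof.
move=> s1 f2; have [iRe iIm] := cintegrable_L2_weight s1 f2.
case: alpha => a b.
have E x : - complex.Im ((a +i* b) * f x) * weight (s^-1 *: x) =
    (- a) * complex.Im (f x * (weight (s^-1 *: x))%:C) +
    (- b) * complex.Re (f x * (weight (s^-1 *: x))%:C).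
  by case: (f x) => u v /=; ring.
have i1 := integrableZl measurableT (- a) iIm.
have i2 := integrableZl measurableT (- b) iRe.
split.
  rewrite (_ : EFin \o _ = (fun x : V =>
    (- a)%:E * (complex.Im (f x * (weight (s^-1 *: x))%:C))%:E +
    (- b)%:E * (complex.Re (f x * (weight (s^-1 *: x))%:C))%:E)%E).
    exact: integrableD.
  by apply/funext => x; rewrite /= E.
under eq_Rintegral do rewrite E.
rewrite RintegralD// !RintegralZl// /MR /cintegral /=.
by rewrite opprD !mulNr.
Qed.

Lemma MR_scale (alpha : R[i]) (f : V -> R[i]) (s c : R) : 1 <= s -> L2 f ->
  MR alpha (fun x => c%:C * f x) s = c * MR alpha f s.
Proof.
move=> s1 f2; have [iRe iIm] := cintegrable_L2_weight s1 f2.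
rewrite /MR /cintegral.
have -> : \int[mu]_x complex.Re (c%:C * f x * (weight (s^-1 *: x))%:C) =
    c * \int[mu]_x complex.Re (f x * (weight (s^-1 *: x))%:C).
  rewrite -RintegralZl//; apply: eq_Rintegral => x _.
  by case: (f x) => u v /=; ring.
have -> : \int[mu]_x complex.Im (c%:C * f x * (weight (s^-1 *: x))%:C) =
    c * \int[mu]_x complex.Im (f x * (weight (s^-1 *: x))%:C).
  rewrite -RintegralZl//; apply: eq_Rintegral => x _.
  by case: (f x) => u v /=; ring.
by case: alpha => a b /=; ring.
Qed.

(** * Lower bound for the mean *)

Definition cube (r : R) : set V := [set x | forall i, r <= x 0 i <= 2 * r].

Lemma measurable_cube r : measurable (cube r).
Proof.
rewrite (_ : cube r =
    \bigcap_(i in [set: 'I_n]) (fun x : V => x 0 i) @^-1` `[r, 2 * r]).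
  apply: fin_bigcap_measurable => // i _.
  by rewrite -[X in measurable X]setTI; exact: measurable_coord.
apply/seteqP; split=> x /= Ax i.
  by move=> _; rewrite /= in_itv/=; exact: Ax.
by have := Ax i I; rewrite /= in_itv.
Qed.

Lemma lebesgue_cube r : 0 <= r -> mu (cube r) = (r ^+ n)%:E.
Proof.
move=> r0.
have -> : cube r = [set x : V | forall i, `[r, 2 * r]%classic (x 0 i)].
  by apply/seteqP; split=> x /= Ax i; have := Ax i; rewrite /= in_itv.
rewrite (@lebesgue_row_box _ _ (fun=> `[r, 2 * r]%classic))//.
under eq_bigr => i _.
  rewrite lebesgue_measure_itv/=.
  over.
have -> : (if (r%:E < (2 * r)%:E)%E
    then ((2 * r)%:E + (- r)%:E)%E else 0%E) = r%:E.
  case: ifPn => [_|]; first by rewrite -EFinD; congr EFin; ring.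
  rewrite lte_fin -leNgt => r2; congr EFin; lra.
by rewrite prodEFin prodr_const card_ord.
Qed.

Lemma integral_cube r : 0 <= r ->
  (\int[mu]_x (\1_(cube r) x)%:E)%E = (r ^+ n)%:E.
Proof.
move=> r0; rewrite integral_indic//; last exact: measurable_cube.
rewrite setIT; exact: lebesgue_cube.
Qed.

Lemma integrable_cube r : 0 <= r ->
  mu.-integrable setT (fun x => (\1_(cube r) x)%:E).
Proof.
move=> r0; have mr := measurable_cube r; apply/integrableP; split.
  exact/measurable_EFinP.
under eq_integral do rewrite gee0_abs ?lee_fin//.
by rewrite integral_cube// ltry.
Qed.

Lemma enorm_cube r x : (0 < n)%N -> 0 <= r -> cube r x ->
  r <= enorm x <= 2 * Num.sqrt n%:R * r.
Proof.
move=> n0 r0 xr; apply/andP; split.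
  rewrite -ler_sqr ?nnegrE ?enorm_ge0// sqr_enorm (bigD1 (Ordinal n0))//=.
  have /andP[x0 _] := xr (Ordinal n0).
  apply: ler_wpDr; first by rewrite sumr_ge0// => j _; exact: sqr_ge0.
  by rewrite ler_sqr ?nnegrE// (le_trans r0).
have rhs0 : 0 <= 2 * Num.sqrt n%:R * r :> R by rewrite !mulr_ge0 ?sqrtr_ge0.
rewrite -ler_sqr ?nnegrE ?enorm_ge0// sqr_enorm.
apply: (@le_trans _ _ (\sum_(i < n) (2 * r) ^+ 2)).
  apply: ler_sum => i _; have /andP[x1 x2] := xr i.
  have x0 := le_trans r0 x1.
  by rewrite ler_sqr ?nnegrE// (le_trans x0).
rewrite sumr_const card_ord [2 * _ * r]mulrAC [leRHS]exprMn sqr_sqrtr//.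
by rewrite mulr_natr.
Qed.

End weighted_mean.

(** The difference g - f agrees almost everywhere with its absolute value. *)
Lemma ae_le_Rintegral d (T : measurableType d) (R : realType)
    (mu : {measure set T -> \bar R}) (f g : T -> R) :
  mu.-integrable setT (EFin \o f) -> mu.-integrable setT (EFin \o g) ->
  {ae mu, forall x, f x <= g x} -> \int[mu]_x f x <= \int[mu]_x g x.
Proof.
move=> intf intg fg.
have mf : measurable_fun setT f by apply/measurable_EFinP/(measurable_int mu).
have mg : measurable_fun setT g by apply/measurable_EFinP/(measurable_int mu).
rewrite -subr_ge0 -RintegralB// /Rintegral.
rewrite (@ae_eq_integral _ _ _ mu setT (fun x => `|g x - f x|%:E))//.
- by apply: fine_ge0; apply: integral_ge0 => x _; rewrite lee_fin.
- by apply/measurable_EFinP; exact: measurable_funB.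
- apply/measurable_EFinP; apply: measurableT_comp => //.
  exact: measurable_funB.
- by apply: filterS fg => x fgx _; rewrite ger0_norm// subr_ge0.
Qed.

(** On the cube |x| lies between r and a r with a = 2 sqrt n, so the density is
    at least (a r) ^ (-k); the weight at x / s is at least <a> ^ (-n-1), as
    r <= s. The constant function with these values on the cube, extended by
    zero, therefore lies below the integrand almost everywhere. *)
Lemma MR_ge_cube (R : realType) n (alpha : R[i]) (f : 'rV[R]_n -> R[i])
    (k r s : R) :
  (0 < n)%N -> 0 <= k -> 2 <= r -> r <= s -> L2 f ->
  {ae lebesgue_row n, forall x : 'rV[R]_n,
     (if enorm x <= 1 then 0 else enorm x `^ (- k))
       <= - complex.Im (alpha * f x)} ->
  jap (2 * Num.sqrt n%:R) ^- n.+1 * (2 * Num.sqrt n%:R) `^ (- k) *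
    r `^ (n%:R - k) <= MR alpha f s.
Proof.
move=> n0 k0 r2 rs f2 flow.
have r0 : 0 < r by lra.
have s0 : 0 < s by lra.
have [|iw ->] := @MR_integral _ _ alpha f s _ f2; first lra.
set a := 2 * Num.sqrt n%:R.
have a0 : 0 < a by rewrite mulr_gt0// sqrtr_gt0 ltr0n.
pose c := jap a ^- n.+1 * (a * r) `^ (- k).
have -> : jap a ^- n.+1 * a `^ (- k) * r `^ (n%:R - k) =
    \int[lebesgue_row n]_x (c * \1_(cube r : set 'rV[R]_n) x).
  rewrite /Rintegral.
  under eq_integral do rewrite EFinM.
  rewrite integralZl//; last first.
    by apply: integrable_cube; exact: ltW.
  rewrite integral_cube ?ltW// -EFinM/= /c.
  rewrite (powRM _ (ltW a0) (ltW r0)) powRD; last first.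
    by rewrite (gt_eqF r0) implybT.
  by rewrite powR_mulrn ?ltW//; ring.
apply: ae_le_Rintegral => //.
  rewrite (_ : EFin \o _ = (fun x =>
    c%:E * (\1_(cube r : set 'rV[R]_n) x)%:E)%E)//.
  by apply: integrableZl => //; apply: integrable_cube; exact: ltW.
apply: filterS flow => x fx; rewrite indicE.
have w0 := weight_gt0 (s^-1 *: x).
have [xr|xr] := boolP (x \in cube r); last first.
  rewrite mulr0 mulr_ge0 ?(ltW w0)//; apply: le_trans fx.
  by case: ifP => // _; exact: powR_ge0.
have /andP[x1 x2] := enorm_cube n0 (ltW r0) (set_mem xr).
rewrite mulr1 /c mulrC.
have w : jap a ^- n.+1 <= weight (s^-1 *: x).
  rewrite weight_scaleE ?invr_ge0 ?(ltW s0)//.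
  rewrite lef_pV2 ?posrE ?exprn_gt0 ?jap_gt0//.
  rewrite lerXn2r ?nnegrE ?(ltW (jap_gt0 _))//.
  apply: ler_jap; first by rewrite mulr_ge0 ?enorm_ge0// invr_ge0 ltW.
  by rewrite mulrC ler_pdivrMr// (le_trans x2)// -/a (ler_wpM2l (ltW a0)).
apply: ler_pM => //; first exact: powR_ge0.
  by rewrite invr_ge0 exprn_ge0// (ltW (jap_gt0 _)).
apply: le_trans fx; rewrite ifF; last by apply/negbTE; rewrite -ltNge; lra.
have ex0 : 0 < enorm x by lra.
have ar0 : 0 < a * r by rewrite (mulr_gt0 a0).
rewrite !powRN lef_pV2 ?posrE ?(powR_gt0 _ ex0) ?(powR_gt0 _ ar0)//.
by apply: ge0_ler_powR => //; rewrite nnegrE ltW.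
Qed.

(** If n <= k the cubes far out do not contribute more than the near ones, so
    only the fixed cube r = 2 is kept; otherwise the largest admissible cube
    r = s is used. *)
Lemma MR_growth (R : realType) n (alpha : R[i]) (f : 'rV[R]_n -> R[i]) (k : R) :
  (0 < n)%N -> 0 <= k -> L2 f ->
  {ae lebesgue_row n, forall x : 'rV[R]_n,
     (if enorm x <= 1 then 0 else enorm x `^ (- k))
       <= - complex.Im (alpha * f x)} ->
  exists2 c : R, 0 < c &
    forall s, 2 <= s -> c * s `^ (n%:R - Num.min n%:R k) <= MR alpha f s.
Proof.
move=> n0 k0 f2 flow; set a : R := 2 * Num.sqrt n%:R.
have a0 : 0 < a by rewrite mulr_gt0// sqrtr_gt0 ltr0n.
have b0 : 0 < jap a ^- n.+1 * a `^ (- k).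
  by rewrite mulr_gt0 ?powR_gt0// invr_gt0 exprn_gt0// jap_gt0.
have [nk|kn] := leP (n%:R : R) k.
  exists (jap a ^- n.+1 * a `^ (- k) * 2 `^ (n%:R - k)).
    by rewrite mulr_gt0// powR_gt0.
  by move=> s s2; rewrite subrr powRr0 mulr1; exact: MR_ge_cube.
exists (jap a ^- n.+1 * a `^ (- k)) => // s s2.
exact: MR_ge_cube.
Qed.

(** * Choice of the radius *)

(** Half of the mean, mu c / 2 r ^ (N - q), absorbs the loss
    K r ^ (N - 1/(p-1)) as soon as mu r ^ e exceeds 2 K / c, where
    e = 1/(p-1) - q > 0. Requiring mu r ^ e = B for a constant B above that
    threshold turns the half mean into B c / 2 r ^ (N - 1/(p-1)), and then all
    powers of r in the time bound add up to r ^ 1. The restriction on mu is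
    what keeps r >= 2. *)
Lemma optimal_radius (R : realType) (p q N c K : R) :
  1 < p -> q < (p - 1)^-1 -> 0 < c -> 0 <= K ->
  exists2 mu0 : R, 0 < mu0 & exists2 C : R, 0 < C &
    forall mu, 0 < mu -> mu < mu0 -> exists2 r : R, 2 <= r &
      K * r `^ (N - (p - 1)^-1) <= mu * c / 2 * r `^ (N - q) /\
      r `^ (N * (p - 1)) * (mu * c / 2 * r `^ (N - q)) `^ (- p + 1) =
        C * mu `^ (- (1 / ((p - 1)^-1 - q))).
Proof.
move=> p1; set sg := (p - 1)^-1 => qs c0 K0.
pose e := sg - q; have e0 : 0 < e by rewrite subr_gt0.
(* The summand 1 keeps B positive when K = 0. *)
pose B := 2 * K / c + 1.
have B0 : 0 < B by rewrite ltr_wpDl// !mulr_ge0// invr_ge0 ltW.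
have KB : K <= B * c / 2.
  rewrite /B mulrDl mulfVK ?gt_eqF//; lra.
exists (B / 2 `^ e); first by rewrite divr_gt0// powR_gt0.
exists ((B * c / 2) `^ (- p + 1) * B `^ e^-1).
  by rewrite mulr_gt0 ?powR_gt0// divr_gt0// mulr_gt0.
move=> mu mu0 muB; pose r := (B / mu) `^ e^-1.
have r0 : 0 < r by rewrite powR_gt0// divr_gt0.
have re : r `^ e = B / mu.
  by rewrite -powRrM mulVf ?gt_eqF// powRr1// ltW// divr_gt0.
have rD x y : r `^ (x + y) = r `^ x * r `^ y.
  by rewrite powRD// (gt_eqF r0) implybT.
(* This uses mu = B r ^ (- e). *)
have key : mu * c / 2 * r `^ (N - q) = B * c / 2 * r `^ (N - sg).
  rewrite (_ : N - q = e + (N - sg)); last by rewrite /e; ring.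
  by rewrite (rD e) re; field; rewrite gt_eqF.
exists r.
  have -> : 2 = (2 `^ e) `^ e^-1 :> R by rewrite -powRrM divff ?gt_eqF// powRr1.
  apply: ge0_ler_powR; rewrite ?nnegrE ?powR_ge0 ?invr_ge0 ?(ltW e0)//.
    by rewrite divr_ge0// ltW.
  by rewrite ler_pdivlMr// mulrC -ler_pdivlMr ?powR_gt0// ltW.
rewrite key; split; first by rewrite ler_wpM2r// powR_ge0.
have p10 : p - 1 != 0 by rewrite gt_eqF// subr_gt0.
rewrite powRM ?powR_ge0//; last by rewrite ltW// divr_gt0// mulr_gt0.
rewrite -powRrM mulrCA -rD (_ : N * _ + _ = 1); last by rewrite /sg; field.
rewrite powRr1 ?(ltW r0)// -[RHS]mulrA; congr (_ * _).
have muV0 : 0 <= mu^-1 by rewrite invr_ge0 ltW.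
rewrite /r (powRM _ (ltW B0) muV0); congr (_ * _).
by rewrite -(@powR_inv1 _ mu) ?ltW// -powRrM mul1r mulN1r.
Qed.

(** * The existence time *)

Lemma le_powR_le0 (R : realType) (x y a : R) :
  0 < x -> x <= y -> a <= 0 -> y `^ a <= x `^ a.
Proof.
move=> x0 xy a0; have y0 := lt_le_trans x0 xy.
rewrite -(opprK a) (powRN y) (powRN x) lef_pV2 ?posrE ?powR_gt0//.
by apply: ge0_ler_powR; rewrite ?nnegrE ?oppr_ge0// ltW.
Qed.

Lemma Dconst_ge0 (R : realType) n (p : R) (lambda alpha : R[i]) :
  0 <= complex.Re (alpha * lambda) -> 0 <= Dconst n p lambda alpha.
Proof. by move=> h; rewrite !mulr_ge0 ?powR_ge0// invr_ge0. Qed.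

Theorem corollary1p12 (R : realType) (n : nat) (n_ge1 : (1 <= n)%N)
    (A : R) (A_gt0 : 0 < A) (A_bound : half_laplacian_bound n A)
    (K : 'rV[R]_n -> R[i]) (K_bessel : bessel_kernel K)
    (p : R) (p_gt1 : 1 < p) (lambda : R[i]) (lambda_neq0 : lambda != 0)
    (alpha : R[i]) (Re_gt0 : 0 < complex.Re (alpha * lambda))
    (k : R) (k_gt : n%:R / 2 < k) (k_lt : k < (p - 1)^-1)
    (f : 'rV[R]_n -> R[i]) (f_L2 : L2 f)
    (f_low : {ae lebesgue_row n, forall x : 'rV[R]_n,
       (if enorm x <= 1 then 0 else enorm x `^ (- k))
         <= - complex.Im (alpha * f x)}) :
  exists mu0 : R, 0 < mu0 /\ exists C : R, 0 < C /\
    forall mu : R, 0 < mu -> mu < mu0 ->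
    let u0 := fun x : 'rV[R]_n => mu%:C * f x in
    exists m0 : R, 0 < m0 /\ forall m : R, 0 <= m -> m <= m0 ->
      exists R2 : R, 0 < R2 /\
        Ctilde A K p lambda alpha * jap (R2 * m) `^ ((n%:R + 2) / (p - 1))
          * R2 `^ (n%:R - (p - 1)^-1) < MR alpha u0 R2 /\
        Ttilde A K p m lambda alpha u0 R2
          <= C * mu `^ (- (1 / ((p - 1)^-1 - Num.min n%:R k))).
Proof.
have k_ge0 : 0 <= k by rewrite ltW// (le_lt_trans _ k_gt)// divr_ge0.
have [c c_gt0 MR_ge] := MR_growth n_ge1 k_ge0 f_L2 f_low.
set q := Num.min _ _ in MR_ge *.
have q_lt : q < (p - 1)^-1 by rewrite (le_lt_trans _ k_lt)// ge_min lexx orbT.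
set Ct := Ctilde A K p lambda alpha.
have Ct_ge0 : 0 <= Ct by exact: powR_ge0.
pose J := jap (1 : R) `^ ((n%:R + 2) / (p - 1)).
have CJ_ge0 : 0 <= Ct * J by rewrite mulr_ge0// powR_ge0.
have [mu0 mu0_gt0 [C C_gt0 radius]] :=
  optimal_radius n%:R p_gt1 q_lt c_gt0 CJ_ge0.
set D := Dconst n p lambda alpha.
have D_ge0 : 0 <= D by exact/Dconst_ge0/ltW.
have p1_gt0 : 0 < p - 1 by rewrite subr_gt0.
(* The summand 1 makes the constant positive from D >= 0 alone. *)
exists mu0; split=> //; exists (((p - 1)^-1 * D^-1 + 1) * C); split.
  by rewrite mulr_gt0// ltr_wpDl// mulr_ge0// invr_ge0// ltW.
move=> mu mu_gt0 mu_lt u0.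
have [r r_ge2 [CJ_le bound]] := radius mu mu_gt0 mu_lt.
have r_gt0 : 0 < r by exact: lt_le_trans r_ge2.
exists r^-1; split; first by rewrite invr_gt0.
move=> m m_ge0 m_le; exists r; split=> //.
have jap_le : jap (r * m) `^ ((n%:R + 2) / (p - 1)) <= J.
  have e_ge0 : 0 <= (n%:R + 2) / (p - 1).
    by rewrite divr_ge0 ?(ltW p1_gt0)// addr_ge0.
  apply: ge0_ler_powR; rewrite ?nnegrE ?(ltW (jap_gt0 _))//.
  apply: ler_jap; first by rewrite mulr_ge0// ltW.
  by rewrite mulrC -ler_pdivlMr// div1r.
have loss_le : Ct * jap (r * m) `^ ((n%:R + 2) / (p - 1)) *
    r `^ (n%:R - (p - 1)^-1) <= mu * c / 2 * r `^ (n%:R - q).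
  by apply: le_trans CJ_le; rewrite ler_wpM2r ?powR_ge0// ler_wpM2l.
have half_gt0 : 0 < mu * c / 2 * r `^ (n%:R - q).
  by rewrite mulr_gt0 ?powR_gt0// divr_gt0// mulr_gt0.
have MR_le : 2 * (mu * c / 2 * r `^ (n%:R - q)) <= MR alpha u0 r.
  rewrite MR_scale//; last by rewrite (le_trans _ r_ge2)// ler1n.
  rewrite (_ : 2 * _ = mu * (c * r `^ (n%:R - q))); last by field.
  by rewrite ler_wpM2l ?MR_ge// ltW.
(* The loss is at most half of the mean, so the difference in the time bound
   is at least the other half. *)
split; first lra.
rewrite /Ttilde -/Ct -/D [jap _ `^ _ * Ct]mulrC -[leLHS]mulrA -[leRHS]mulrA.
rewrite -bound; apply: ler_pM.
- by rewrite mulr_ge0 ?invr_ge0// ltW.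
- by rewrite mulr_ge0 ?powR_ge0.
- by rewrite lerDl.
apply: (ler_wpM2l (powR_ge0 _ _)).
by apply: le_powR_le0; [exact: half_gt0 | lra | rewrite addrC subr_le0 ltW].
Qed.
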